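(* Let $N\geq 1$, $L>0$, and let $\mathcal{D}\subseteq \mathcal{S}^{N-1}$ be a finite set. Then $\mathcal{D}$ is a proper quantization for the class $\mathcal{F}_L(\mathbb{R}^N)$ if and only if there exists $\theta\in[0,\pi/2)$ such that $\mathcal{D}$ is a $\theta$-cover.
   Context: $\|\cdot\|$ is the Euclidean norm, $\mathcal{S}^{N-1}$ is the unit sphere in $\mathbb{R}^N$, and $\mathrm{dist}(x,\mathcal{Y})=\inf_{v\in\mathcal{Y}}\|v-x\|$. Class $\mathcal{F}_L(\mathbb{R}^N)$: the set of functions $f:\mathbb{R}^N\to\mathbb{R}$ that are convex and differentiable with $L$-Lipschitz continuous gradient and whose set of minimizers $\mathcal{X}^\star=\arg\min_{x\in\mathbb{R}^N} f(x)$ is nonempty and bounded. Proper quantization: a finite set $\mathcal{D}\subseteq\mathcal{S}^{N-1}$ is a proper quantization for $\mathcal{F}_L(\mathbb{R}^N)$ if for every $f\in\mathcal{F}_L(\mathbb{R}^N)$ and every initialization $x(0)\in\mathbb{R}^N$ one can choose $d(t)\in\mathcal{D}$ and $\gamma(t)\in\mathbb{R}_+=[0,\infty)$ for all $t=0,1,2,\ldots$ such that the iterates $x(t+1)=x(t)-\gamma(t)d(t)$ satisfy $\lim_{t\to\infty}\mathrm{dist}(x(t),\mathcal{X}^\star)=0$. $\theta$-cover: a finite set $\mathcal{D}\subseteq\mathcal{S}^{N-1}$ is a $\theta$-cover if $\theta\in[0,\pi/2)$ and for all $g\in\mathcal{S}^{N-1}$ there is $d\in\mathcal{D}$ such that $\cos^{-1}(\langle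 g,d\rangle)\leq\theta$. *)

(* Defs.v *)
From HB Require Import structures.
From mathcomp Require Import all_boot all_order all_algebra.
From mathcomp Require Import all_classical all_reals all_analysis.

Set Implicit Arguments.
Unset Strict Implicit.
Unset Printing Implicit Defensive.

Import Order.TTheory GRing.Theory Num.Theory.
Import numFieldNormedType.Exports.

Local Open Scope classical_set_scope.
Local Open Scope ring_scope.

(** Vectors of R^N are row vectors. The library norm [`|x|] on ['rV[R]_N] is
    the sup norm, hence the Euclidean structure below. The topology, and so
    the library's [differentiable], does not depend on this choice. *)

Definition dotp (R : realType) (N : nat) (u v : 'rV[R]_N) : R :=
  \sum_(i < N) u ord0 i * v ord0 i.

Definition enorm (R : realType) (N : nat) (u : 'rV[R]_N) : R :=
  Num.sqrt (dotp u u).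

Definition unit_sphere (R : realType) (N : nat) : set 'rV[R]_N :=
  [set u | enorm u = 1].

(** [inf set0 = 0]: only meaningful for nonempty [Y]. *)
Definition edistance (R : realType) (N : nat) (x : 'rV[R]_N)
    (Y : set 'rV[R]_N) : R :=
  inf [set enorm (v - x) | v in Y].

Definition gradient (R : realType) (N : nat) (f : 'rV[R]_N -> R)
    (x : 'rV[R]_N) : 'rV[R]_N :=
  \row_(i < N) 'D_(delta_mx ord0 i) f x.

Definition argmin (R : realType) (N : nat) (f : 'rV[R]_N -> R) :
    set 'rV[R]_N :=
  [set x | forall y, f x <= f y].

Definition smooth_convex_class (R : realType) (N : nat) (L : R) :
    set ('rV[R]_N -> R) :=
  [set f |
    [/\ convex_function [set: convex_lmodType 'rV[R]_N] f,
        forall x, differentiable f x,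
        forall x y, enorm (gradient f x - gradient f y) <= L * enorm (x - y),
        argmin f !=set0 &
        exists M : R, forall x, argmin f x -> enorm x <= M]].

Definition proper_quantization (R : realType) (N : nat) (L : R)
    (D : set 'rV[R]_N) : Prop :=
  forall f, smooth_convex_class L f -> forall x0 : 'rV[R]_N,
    exists (d : nat -> 'rV[R]_N) (gamma : nat -> R) (x : nat -> 'rV[R]_N),
      [/\ forall t, D (d t),
          forall t, 0 <= gamma t,
          x 0%N = x0,
          forall t, x t.+1 = x t - gamma t *: d t &
          edistance (x t) (argmin f) @[t --> \oo] --> (0 : R)].

Definition theta_cover (R : realType) (N : nat) (theta : R)
    (D : set 'rV[R]_N) : Prop :=
  0 <= theta < pi / 2 /\
  forall g, unit_sphere g -> exists2 d, D d & acos (dotp g d) <= theta.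

(* Main.v *)
Require Import Defs.
From HB Require Import structures.
From mathcomp Require Import all_boot all_order all_algebra.
From mathcomp Require Import all_classical all_reals all_analysis.
From mathcomp Require Import ring lra.

(** Both conditions amount to a third one: every unit vector [g] has some
    [d] in [D] with [0 < dotp g d], that is, no closed half-space through the
    origin contains [D].

    A [theta]-cover with [theta < pi / 2] gives such a [d], even with
    [cos theta <= dotp g d]. Conversely, when [D] is finite, the best inner
    product of [g] with [D] is continuous in [g], hence bounded below by some
    [c > 0] on the compact sphere ([uniformly_positive_dotp]), and
    [theta = acos c] works.

    If some unit [g] has [dotp g d <= 0] for all [d] in [D], moving against
    directions of [D] never decreases [dotp g]. Minimizing the quadratic
    [L / 2 * dotp x x] from [g] then fails
    ([proper_quantization_dotp_gt0]).

    If [D] is a [theta]-cover, take at each point the direction of [D] within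
    [theta] of the gradient, with a step proportional to its inner product with
    the gradient. By smoothness each step decreases [f] by a fixed multiple of
    the squared norm of the gradient ([step_decrease]). Sublevel sets of [f] are
    bounded because its set of minimizers is ([convex_sublevel_bounded]), so by
    convexity a small gradient means a value close to the minimum, and the
    values tend to the minimum ([sufficient_decrease_cvg]). On a bounded set
    this forces the distance to the minimizers to vanish, by compactness
    ([argmin_edistance_cvg]). *)

Import Order.TTheory GRing.Theory Num.Theory.
Import numFieldNormedType.Exports.

Set Implicit Arguments.
Unset Strict Implicit.

Local Open Scope classical_set_scope.
Local Open Scope ring_scope.

(** * The Euclidean inner product on row vectors *)

Section euclidean.
Context {R : realType} {N : nat}.
Implicit Types (u v w x : 'rV[R]_N) (a r : R).

Lemma dotpC u v : dotp u v = dotp v u.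
Proof. by apply: eq_bigr => i _; rewrite mulrC. Qed.

Lemma dotpDl u v w : dotp (u + v) w = dotp u w + dotp v w.
Proof.
by rewrite /dotp -big_split; apply: eq_bigr => i _; rewrite mxE mulrDl.
Qed.

Lemma dotpZl a u v : dotp (a *: u) v = a * dotp u v.
Proof.
by rewrite /dotp mulr_sumr; apply: eq_bigr => i _; rewrite mxE mulrA.
Qed.

Lemma dotp0l v : dotp 0 v = 0.
Proof. by rewrite -(scale0r 0) dotpZl mul0r. Qed.

Lemma dotpNl u v : dotp (- u) v = - dotp u v.
Proof. by rewrite -scaleN1r dotpZl mulN1r. Qed.

Lemma dotpDr u v w : dotp u (v + w) = dotp u v + dotp u w.
Proof. by rewrite dotpC dotpDl !(dotpC u). Qed.

Lemma dotpZr a u v : dotp u (a *: v) = a * dotp u v.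
Proof. by rewrite dotpC dotpZl dotpC. Qed.

Lemma dotpNr u v : dotp u (- v) = - dotp u v.
Proof. by rewrite dotpC dotpNl dotpC. Qed.

Definition dotpE := (dotpDl, dotpDr, dotpNl, dotpNr, dotpZl, dotpZr).

Lemma dotp_ge0 u : 0 <= dotp u u.
Proof. by apply: sumr_ge0 => i _; rewrite -expr2 sqr_ge0. Qed.

Lemma dotp_eq0 u : dotp u u = 0 -> u = 0.
Proof.
move=> u0; apply/rowP => i; rewrite mxE.
have sq_ge0 (j : 'I_N) : true -> 0 <= u ord0 j * u ord0 j.
  by rewrite -expr2 sqr_ge0.
move/eqP: u0; rewrite psumr_eq0 // => /allP/(_ i).
by rewrite mem_index_enum mulf_eq0 orbb => /(_ isT)/eqP.
Qed.

Lemma dotp_deltar u (i : 'I_N) : dotp u (delta_mx ord0 i) = u ord0 i.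
Proof.
rewrite /dotp (bigD1 i) //= big1 => [|j ji]; rewrite mxE eqxx /=.
  by rewrite eqxx mulr1 addr0.
by rewrite (negbTE ji) mulr0.
Qed.

Lemma enorm_ge0 u : 0 <= enorm u.
Proof. exact: sqrtr_ge0. Qed.

Lemma enorm_sqr u : enorm u ^+ 2 = dotp u u.
Proof. by rewrite sqr_sqrtr // dotp_ge0. Qed.

Lemma enorm0 : enorm (0 : 'rV[R]_N) = 0.
Proof. by rewrite /enorm dotp0l sqrtr0. Qed.

Lemma enorm_eq0 u : enorm u = 0 -> u = 0.
Proof. by move=> u0; apply: dotp_eq0; rewrite -enorm_sqr u0 expr0n. Qed.

Lemma enorm_gt0 u : u != 0 -> 0 < enorm u.
Proof.
move=> u0; rewrite lt_def enorm_ge0 andbT.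
by apply: contra_neq u0; exact: enorm_eq0.
Qed.

Lemma enormZ a u : enorm (a *: u) = `|a| * enorm u.
Proof.
by rewrite /enorm dotpZl dotpZr mulrA -expr2 sqrtrM ?sqr_ge0 // sqrtr_sqr.
Qed.

Lemma enormN u : enorm (- u) = enorm u.
Proof. by rewrite -scaleN1r enormZ normrN1 mul1r. Qed.

Lemma enorm_normalize u : u != 0 -> enorm ((enorm u)^-1 *: u) = 1.
Proof.
move=> /enorm_gt0 u0.
by rewrite enormZ ger0_norm ?invr_ge0 ?enorm_ge0 // mulVf // gt_eqF.
Qed.

Lemma cauchy_schwarz u v : dotp u v <= enorm u * enorm v.
Proof.
have [->|/enorm_gt0 u0] := eqVneq u 0.
  by rewrite enorm0 mul0r dotp0l.
have [->|/enorm_gt0 v0] := eqVneq v 0.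
  by rewrite enorm0 mulr0 dotpC dotp0l.
have := dotp_ge0 (enorm v *: u - enorm u *: v).
rewrite !dotpE -!enorm_sqr (dotpC v u) => sq_ge0.
rewrite -(ler_pM2l (mulr_gt0 u0 v0)); nra.
Qed.

Lemma dotp_unit_itv u v : enorm u = 1 -> enorm v = 1 -> -1 <= dotp u v <= 1.
Proof.
move=> u1 v1; apply/andP; split.
  have := cauchy_schwarz (- u) v.
  by rewrite enormN u1 v1 mulr1 dotpNl lerNl.
by have := cauchy_schwarz u v; rewrite u1 v1 mulr1.
Qed.

Lemma enormD u v : enorm (u + v) <= enorm u + enorm v.
Proof.
have uv0 : 0 <= enorm u + enorm v by rewrite addr_ge0 ?enorm_ge0.
rewrite -(ler_pXn2r (_ : 0 < 2)%N) ?nnegrE ?enorm_ge0 //.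
rewrite sqrrD !enorm_sqr !dotpE (dotpC v u).
by have := cauchy_schwarz u v; lra.
Qed.

Lemma continuous_dotpl v : continuous (fun u => dotp u v).
Proof.
have -> : (fun u => dotp u v) = \sum_(i < N) (fun u => u ord0 i * v ord0 i).
  by apply/funext => u; rewrite fct_sumE.
move=> x; apply/differentiable_continuous/differentiable_sum => i.
by apply: differentiableM; [exact: differentiable_coord|].
Qed.

Lemma differentiable_dotpp x : differentiable (fun u => dotp u u) x.
Proof.
have -> : (fun u => dotp u u) = \sum_(i < N) (fun u => u ord0 i * u ord0 i).
  by apply/funext => u; rewrite fct_sumE.
apply: differentiable_sum => i.
by apply: differentiableM; exact: differentiable_coord.
Qed.

Lemma continuous_enorm : continuous (@enorm R N).
Proof.
move=> x; apply: continuous_comp; last exact: sqrt_continuous.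
exact/differentiable_continuous/differentiable_dotpp.
Qed.

Lemma continuous_enormB v : continuous (fun u => enorm (u - v)).
Proof.
move=> x; apply: (@continuous_comp _ _ _ (fun u => u - v)).
  exact: cvgB cvg_id (cvg_cst _).
exact: continuous_enorm.
Qed.

Lemma norm_le_enorm u : `|u| <= enorm u.
Proof.
rewrite /Num.norm /= mx_normrE; apply/bigmax_leP; split=> [|[i j] _ /=].
  exact: enorm_ge0.
rewrite (ord1 i) -sqrtr_sqr ler_sqrt ?dotp_ge0 // expr2 /dotp (bigD1 j) //=.
by rewrite lerDl sumr_ge0 // => k _; rewrite -expr2 sqr_ge0.
Qed.

(** Heine-Borel, in the form used throughout: the sets that are minimized over
    below are cut out of a Euclidean ball by continuous conditions. *)
Lemma compact_of_enorm_ball (A : set 'rV[R]_N) v r :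
  closed A -> A `<=` [set u | enorm (u - v) <= r] -> compact A.
Proof.
move=> Acl Ar; apply: bounded_closed_compact => //.
exists (r + enorm v); split; first exact: num_real.
move=> M rM x /Ar /= xr; apply: le_trans (norm_le_enorm x) _.
rewrite -(subrK v x); apply: le_trans (enormD _ _) _.
by apply: ltW; apply: le_lt_trans rM; rewrite lerD2r.
Qed.

Lemma compact_sphere v r : compact [set u : 'rV[R]_N | enorm (u - v) = r].
Proof.
apply: (@compact_of_enorm_ball _ v r); last by move=> u /= ->.
apply: (@preimage_closed _ _ (fun u => enorm (u - v)) [set x | x = r]).
  by move=> u _; exact: continuous_enormB.
exact: closed_eq.
Qed.

End euclidean.

(** * First-order convexity *)

Section convex.
Context {R : realType} {N : nat}.
Implicit Types (f : 'rV[R]_N -> R) (u v x y : 'rV[R]_N).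

Lemma derive_gradient f x v :
  differentiable f x -> 'D_v f x = dotp (gradient f x) v.
Proof.
move=> fx; rewrite deriveE // [in LHS](row_sum_delta v) linear_sum.
by apply: eq_bigr => i _; rewrite linearZ mxE deriveE // mulrC.
Qed.

Lemma convex_functionP f x y (t : R) :
    convex_function [set: convex_lmodType 'rV[R]_N] f -> 0 <= t <= 1 ->
  f (t *: x + (1 - t) *: y) <= t * f x + (1 - t) * f y.
Proof.
move=> cvxf /andP[t0 t1].
by have := cvxf (Itv01 t0 t1) x y; apply; rewrite inE.
Qed.

(** A difference quotient of [f] from [x] towards [y] is at most [f y - f x],
    and so is its limit, the derivative of [f] along [y - x]. *)
Lemma convex_gradient_le f x y :
    convex_function [set: convex_lmodType 'rV[R]_N] f -> differentiable f x ->
  dotp (gradient f x) (y - x) <= f y - f x.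
Proof.
move=> cvxf fx; rewrite -derive_gradient //.
have dfx := @diff_derivable _ _ _ _ _ (y - x) fx.
apply: (cvgr_to_le (cvg_dnbhs_at_right dfx)); near=> h.
have h0 : 0 < h by near: h; exact: nbhs_right_gt.
have h1 : h < 1 by near: h; exact: nbhs_right_lt.
rewrite /GRing.scale /= ler_pdivrMl //.
have -> : h *: (y - x) + x = h *: y + (1 - h) *: x.
  by rewrite scalerBr scalerBl scale1r addrAC addrA.
have h01 : 0 <= h <= 1 by rewrite !ltW.
by have := convex_functionP y x cvxf h01; lra.
Unshelve. all: by end_near.
Qed.

(** The quadratic upper bound. The constant [L] in place of the sharp [L / 2]
    spares an integration: the gradient inequality at [x + v] bounds the
    increase by the slope there, which differs from that at [x] by at most
    [L * enorm v]. *)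
Lemma smooth_convex_descent (L : R) f x v : smooth_convex_class L f ->
  f (x + v) <= f x + dotp (gradient f x) v + L * enorm v ^+ 2.
Proof.
case=> cvxf df lipf _ _.
have := @convex_gradient_le f (x + v) x cvxf (df _).
have -> : x - (x + v) = - v by rewrite opprD addrA subrr sub0r.
have := lipf (x + v) x; rewrite addrAC subrr add0r => lip.
have := cauchy_schwarz (gradient f (x + v) - gradient f x) v.
have := ler_wpM2r (enorm_ge0 v) lip.
rewrite !dotpE; lra.
Qed.

(** On a sphere around [xs] large enough to enclose all the minimizers, [f]
    exceeds its minimum by a positive gap. Along a ray from [xs] the secant
    slope of a convex function is nondecreasing, so beyond the sphere [f] grows
    at least linearly. *)
Lemma convex_sublevel_bounded f xs (M : R) :
    convex_function [set: convex_lmodType 'rV[R]_N] f -> continuous f ->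
    argmin f xs -> (forall x, argmin f x -> enorm x <= M) ->
  forall c : R, exists r : R, forall x, f x <= c -> enorm (x - xs) <= r.
Proof.
move=> cvxf cf xsmin argM c.
have M0 : 0 <= M by apply: le_trans (argM _ xsmin); exact: enorm_ge0.
pose r := M + M + 1; have r0 : 0 < r by rewrite /r; lra.
(* Minimizers are within [M + M] of [xs], hence strictly inside [S]. *)
pose S := [set u | enorm (u - xs) = r].
have [S0|S0] := pselect (S !=set0); last first.
  exists 0 => x _; rewrite leNgt; apply/negP => xxs0; apply: S0.
  exists (xs + (r / enorm (x - xs)) *: (x - xs)); rewrite /S /=.
  rewrite addrAC subrr add0r enormZ ger0_norm ?divfK ?gt_eqF //.
  by rewrite divr_ge0 // ltW.
have [z] := compact_EVT_min S0 (@compact_sphere _ _ xs r)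
  (continuous_subspaceT cf).
rewrite inE => zS zmin.
have m0 : 0 < f z - f xs.
  rewrite subr_gt0 lt_def (xsmin z) andbT; apply/negP => /eqP fz.
  have /argM zM : argmin f z by move=> y; rewrite fz.
  have := enormD z (- xs); rewrite enormN zS /r.
  by have := argM _ xsmin; lra.
exists (Num.max r (r * (c - f xs) / (f z - f xs))) => x fxc.
rewrite le_max; case: (leP _ r) => //= rx.
have e0 : 0 < enorm (x - xs) by lra.
pose s := r / enorm (x - xs).
have s0 : 0 < s by rewrite divr_gt0.
have s1 : s <= 1 by rewrite ler_pdivrMr // mul1r ltW.
have : f z <= f (s *: x + (1 - s) *: xs).
  apply: zmin; rewrite inE /S /=.
  have -> : s *: x + (1 - s) *: xs - xs = s *: (x - xs).
    by rewrite scalerBr scalerBl scale1r -addrA [xs - _ - _]addrAC subrr add0r.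
  by rewrite enormZ ger0_norm ?divfK ?gt_eqF // ltW.
have s01 : 0 <= s <= 1 by rewrite s1 ltW.
have := convex_functionP x xs cvxf s01 => hc hz.
rewrite ler_pdivlMr //.
have srE : s * enorm (x - xs) = r by rewrite /s divfK ?gt_eqF.
have : f z - f xs <= s * (c - f xs) by nra.
move/(ler_wpM2l (ltW e0)) => /le_trans; apply.
by rewrite mulrA [_ * s]mulrC srE.
Qed.

(** The points of a ball that are far from all minimizers form a compact set,
    where [f] stays away from its minimum; the sequence must leave it. *)
Lemma argmin_edistance_cvg f xs (r : R) (x : nat -> 'rV[R]_N) :
    continuous f -> argmin f xs -> (forall t, enorm (x t - xs) <= r) ->
    f (x t) @[t --> \oo] --> f xs ->
  edistance (x t) (argmin f) @[t --> \oo] --> (0 : R).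
Proof.
move=> cf xsmin xr fx; apply/cvgrPdist_lt => e e0.
pose K := [set u | enorm (u - xs) <= r] `&`
  \bigcap_(v in argmin f) [set u | e <= enorm (u - v)].
have Kcompact : compact K.
  apply: (@compact_of_enorm_ball _ _ _ xs r) => [|u []//].
  apply: closedI.
    apply: (@preimage_closed _ _ (fun u => enorm (u - xs)) [set y | y <= r]).
      by move=> u _; exact: continuous_enormB.
    exact: closed_le.
  apply: closed_bigI => v _.
  apply: (@preimage_closed _ _ (fun u => enorm (u - v)) [set y | e <= y]).
    by move=> u _; exact: continuous_enormB.
  exact: closed_ge.
have near_argmin : \forall t \near \oo, ~ K (x t).
  have [K0|K0] := pselect (K !=set0); last first.
    by near=> t => Kt; apply: K0; exists (x t).
  have [z] := compact_EVT_min K0 Kcompact (continuous_subspaceT cf).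
  rewrite inE => -[_ zK] zmin.
  have fz : f xs < f z.
    rewrite lt_def (xsmin z) andbT; apply/negP => /eqP fz.
    have /zK /= : argmin f z by move=> y; rewrite fz.
    by rewrite subrr enorm0 leNgt e0.
  near=> t => Kt; have fxt : f (x t) < f z by near: t; exact: cvgr_lt fz.
  by have := zmin (x t) (mem_set Kt); rewrite leNgt fxt.
near=> t; have Kt : ~ K (x t) by near: t.
have [v vmin xv] : exists2 v, argmin f v & enorm (v - x t) < e.
  apply: contrapT => nov; apply: Kt; split => [|v vmin] /=; first exact: xr.
  rewrite leNgt; apply/negP => xv; apply: nov; exists v => //.
  by rewrite -enormN opprB.
have dist0 : lbound [set enorm (v - x t) | v in argmin f] 0.
  by move=> _ [w _ <-]; exact: enorm_ge0.
rewrite sub0r normrN ger0_norm /edistance; last first.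
  by apply: lb_le_inf dist0; exists (enorm (v - x t)), v.
by apply: le_lt_trans xv; apply: ge_inf; [exists 0|exists v].
Unshelve. all: by end_near.
Qed.

End convex.

(** * Sufficient decrease *)

Section descent.
Context {R : realType} {N : nat}.
Implicit Types (f : 'rV[R]_N -> R) (d x : 'rV[R]_N).

(** The step length is the minimizer of the quadratic upper bound of
    [smooth_convex_descent] on the line through [x] along [d]. *)
Lemma step_decrease (L c : R) f x d : 0 < L -> 0 <= c ->
    smooth_convex_class L f -> enorm d = 1 ->
    c * enorm (gradient f x) <= dotp (gradient f x) d ->
  f (x - (dotp (gradient f x) d / (2 * L)) *: d) <=
    f x - c ^+ 2 / (4 * L) * enorm (gradient f x) ^+ 2.
Proof.
move=> L0 c0 fL d1; set g := gradient f x; set a := dotp g d => ca.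
have := smooth_convex_descent x (- ((a / (2 * L)) *: d)) fL.
move/le_trans; apply; rewrite enormN enormZ d1 mulr1 -/g dotpNr dotpZr -/a.
rewrite real_normK ?num_real //.
have -> : f x + - (a / (2 * L) * a) + L * (a / (2 * L)) ^+ 2 =
    f x - a ^+ 2 / (4 * L) by field; rewrite gt_eqF.
rewrite lerD2l lerN2 mulrAC -exprMn ler_pM2r ?invr_gt0 ?mulr_gt0 //.
by rewrite ler_pXn2r ?nnegrE ?(le_trans _ ca) ?mulr_ge0 ?enorm_ge0.
Qed.

(** As long as [f (x t)] exceeds the minimum by a fixed amount, the gradient
    inequality on the bounded sublevel set keeps the gradient away from [0], so
    that [f (x t)] drops by a fixed amount at every step; this cannot last, as
    [f] is bounded below. *)
Lemma sufficient_decrease_cvg (L k : R) f (x : nat -> 'rV[R]_N) :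
    smooth_convex_class L f -> 0 < k ->
    (forall t, f (x t.+1) <= f (x t) - k * enorm (gradient f (x t)) ^+ 2) ->
  edistance (x t) (argmin f) @[t --> \oo] --> (0 : R).
Proof.
move=> [cvxf df _ [xs xsmin] [M argM]] k0 fdec.
have cf : continuous f by move=> y; exact/differentiable_continuous/df.
have fnincr : {homo (f \o x) : s t / (s <= t)%N >-> t <= s}.
  apply/nonincreasing_seqP => t /=; apply: le_trans (fdec t) _.
  by rewrite gerBl mulr_ge0 ?sqr_ge0 // ltW.
have [r xr] := convex_sublevel_bounded cvxf cf xsmin argM (f (x 0%N)).
have {}xr t : enorm (x t - xs) <= r by apply: xr; exact: fnincr.
apply: (@argmin_edistance_cvg _ _ f xs r x) => //.
apply/cvgrPdist_lt => e e0.
suff [T fT] : exists T, f (x T) < f xs + e.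
  exists T => // t /= /fnincr /= fTt.
  by rewrite distrC ger0_norm ?subr_ge0 ?xsmin // ltrBlDl (le_lt_trans fTt).
apply: contrapT => noT.
have fge t : f xs + e <= f (x t).
  by rewrite leNgt; apply/negP => ft; apply: noT; exists t.
have r0 : 0 < r + 1 by have := le_trans (enorm_ge0 _) (xr 0%N); lra.
have grad_ge t : e / (r + 1) <= enorm (gradient f (x t)).
  rewrite ler_pdivrMr //.
  have := convex_gradient_le xs cvxf (df (x t)).
  have := cauchy_schwarz (gradient f (x t)) (x t - xs).
  rewrite -(opprB (x t)) dotpNr.
  have := fge t; have := enorm_ge0 (gradient f (x t)); have := xr t; nra.
pose b := k * (e / (r + 1)) ^+ 2.
have b0 : 0 < b by rewrite mulr_gt0 // exprn_gt0 // divr_gt0.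
have flin t : f (x t) <= f (x 0%N) - b *+ t.
  elim: t => [|t IHt]; first by rewrite mulr0n subr0.
  apply: le_trans (fdec t) _; rewrite mulrSr opprD addrA lerD // lerN2.
  rewrite ler_pM2l // ler_pXn2r ?nnegrE ?enorm_ge0 //.
  by rewrite ltW // divr_gt0.
pose n := (Num.truncn ((f (x 0%N) - f xs) / b)).+1.
have : f (x 0%N) - f xs < b *+ n.
  by rewrite -mulr_natl -ltr_pdivrMr // truncnS_gt.
by have := flin n; have := xsmin (x n); lra.
Qed.

(** * The quadratic test function *)

Lemma derive_sqnorm (L : R) x d :
  'D_d (fun u => L / 2 * dotp u u) x = L * dotp x d.
Proof.
apply: cvg_lim => //.
have : L * dotp x d + h * (L / 2 * dotp d d) @[h --> 0^'] --> L * dotp x d.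
  rewrite -[X in _ --> X]addr0; apply: cvgD; first exact: cvg_cst.
  rewrite -[X in _ --> X](mul0r (L / 2 * dotp d d)).
  by apply: cvg_within_filter; apply: cvgM; [exact: cvg_id|exact: cvg_cst].
apply: cvg_trans; apply: near_eq_cvg; near=> h => /=.
have h0 : h != 0 by near: h; exact: nbhs_dnbhs_neq.
by rewrite /GRing.scale /= !dotpE (dotpC d x); field.
Unshelve. all: by end_near.
Qed.

Lemma gradient_sqnorm (L : R) x :
  gradient (fun u : 'rV[R]_N => L / 2 * dotp u u) x = L *: x.
Proof. by apply/rowP => i; rewrite !mxE derive_sqnorm dotp_deltar. Qed.

Lemma argmin_sqnorm (L : R) : 0 < L ->
  argmin (fun u : 'rV[R]_N => L / 2 * dotp u u) = [set 0].
Proof.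
move=> L0; have L20 : 0 < L / 2 by rewrite divr_gt0.
apply/seteqP; split=> [u /(_ 0)|_ -> u]; rewrite dotp0l mulr0.
  rewrite pmulr_rle0 // => u0; apply: dotp_eq0; apply/eqP.
  by rewrite eq_le u0 dotp_ge0.
by rewrite mulr_ge0 ?dotp_ge0 // ltW.
Qed.

Lemma smooth_convex_sqnorm (L : R) : 0 < L ->
  smooth_convex_class L (fun u : 'rV[R]_N => L / 2 * dotp u u).
Proof.
move=> L0; split.
- move=> t u v _ _.
  have t0 : 0 <= t%:num by [].
  have t1 : t%:num <= 1 by [].
  set s := t%:num in t0 t1.
  pose w := s *: (u : 'rV[R]_N) + (1 - s) *: (v : 'rV[R]_N).
  suff : L / 2 * dotp w w <=
         s * (L / 2 * dotp u u) + (1 - s) * (L / 2 * dotp v v) by [].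
  have -> : s * (L / 2 * dotp u u) + (1 - s) * (L / 2 * dotp v v) =
      L / 2 * (s * dotp u u + (1 - s) * dotp v v) by ring.
  rewrite ler_pM2l ?divr_gt0 // -subr_ge0 /w !dotpE (dotpC v u).
  (* The convexity gap is the squared distance, weighted by [s * (1 - s)]. *)
  set rhs := (X in 0 <= X).
  have -> : rhs = s * (1 - s) * dotp ((u : 'rV[R]_N) - v) ((u : 'rV[R]_N) - v).
    by rewrite !dotpE (dotpC v u) /rhs; ring.
  by rewrite !mulr_ge0 ?dotp_ge0 // subr_ge0.
- by move=> x; apply: differentiableM => //; exact: differentiable_dotpp.
- by move=> u v; rewrite !gradient_sqnorm -scalerBr enormZ ger0_norm // ltW.
- by rewrite argmin_sqnorm //; exists 0.
- by exists 0 => u; rewrite argmin_sqnorm // => ->; rewrite enorm0.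
Qed.

End descent.

(** * Positive angles and covers *)

Section cover.
Context {R : realType} {N : nat}.
Implicit Types (d g : 'rV[R]_N) (D : set 'rV[R]_N).

Lemma ltr_acos (a b : R) : -1 <= a <= 1 -> -1 <= b <= 1 ->
  (acos a < acos b) = (b < a).
Proof.
move=> a1 b1.
by rewrite -ltr_cos ?in_itv /= ?acos_ge0 ?acos_lepi // !acosK ?in_itv.
Qed.

(** As [D] is finite, the best inner product of [g] with [D] is a continuous
    function of [g]; it is positive, and the sphere is compact. *)
Lemma uniformly_positive_dotp D : finite_set D ->
    (forall g, enorm g = 1 -> exists2 d, D d & 0 < dotp g d) ->
  exists2 c : R, 0 < c &
    forall g, enorm g = 1 -> exists2 d, D d & c <= dotp g d.
Proof.
move=> /finite_seqP[s ->] pos.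
pose best g := \big[Num.max/0]_(d <- s) dotp g d.
have cbest : continuous best.
  rewrite /best; elim: (s) => [|d l IHl].
    by under eq_fun do rewrite big_nil; exact: cst_continuous.
  under eq_fun do rewrite big_cons.
  move=> g; apply: (@continuous_max _ _ (fun g => dotp g d)).
    exact: continuous_dotpl.
  exact: IHl.
have sphereE g : (enorm (g - 0) = 1) = (enorm g = 1) by rewrite subr0.
pose S : set 'rV[R]_N := [set g | enorm (g - 0) = 1].
have [S0|S0] := pselect (S !=set0); last first.
  by exists 1 => // g g1; case: S0; exists g; rewrite /S /= sphereE.
have [z] := compact_EVT_min S0 (@compact_sphere _ _ 0 1)
  (continuous_subspaceT cbest).
rewrite inE /S /= sphereE => z1 zmin.
have bestz0 : 0 < best z.
  have [d ds zd] := pos z z1; apply: (lt_le_trans zd).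
  exact: (@le_bigmax_seq _ _ _ s 0 d xpredT (fun d => dotp z d) ds).
exists (best z) => // g g1; apply: contrapT => nod.
have : best z <= best g by apply: zmin; rewrite inE /S /= sphereE.
rewrite leNgt => /negP; apply; rewrite {1}/best big_seq.
apply: bigmax_lt => // d ds; rewrite ltNge; apply/negP => zd.
by apply: nod; exists d.
Qed.

(** If the unit vector [g] has no direction of [D] in its open half-space, then
    the linear form [dotp g] never decreases along an admissible trajectory.
    Started at [g], such a trajectory stays at distance at least [1] from the
    origin, the only minimizer of the quadratic. *)
Lemma proper_quantization_dotp_gt0 (L : R) D : 0 < L ->
    proper_quantization L D ->
  forall g, enorm g = 1 -> exists2 d, D d & 0 < dotp g d.
Proof.
move=> L0 proper g g1; apply: contrapT => nod.
have Dle0 d : D d -> dotp g d <= 0.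
  by move=> Dd; rewrite leNgt; apply/negP => gd; apply: nod; exists d.
have [d [gamma [x [Dd gamma0 x0 xS]]]] := proper _ (smooth_convex_sqnorm L0) g.
rewrite argmin_sqnorm // => dist0.
have xg t : 1 <= dotp g (x t).
  elim: t => [|t IHt]; first by rewrite x0 -enorm_sqr g1 expr1n.
  rewrite xS dotpDr dotpNr dotpZr (le_trans IHt) // lerDl oppr_ge0.
  by rewrite mulr_ge0_le0 // Dle0.
suff : (1 : R) <= 0 by rewrite ler10.
apply: (cvgr_to_ge dist0); near=> t.
apply: lb_le_inf => [|_ [_ -> <-]]; first by exists (enorm (0 - x t)), 0.
rewrite sub0r enormN; apply: le_trans (xg t) _.
by have := cauchy_schwarz g (x t); rewrite g1 mul1r.
Unshelve. all: by end_near.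
Qed.

Lemma uniformly_positive_dotp_theta_cover D (c : R) :
    D !=set0 -> D `<=` @unit_sphere R N -> 0 < c ->
    (forall g, enorm g = 1 -> exists2 d, D d & c <= dotp g d) ->
  exists2 theta : R, 0 <= theta < pi / 2 & theta_cover theta D.
Proof.
move=> [e De] hD c0 cD.
have c1 : c <= 1.
  have [d Dd ed] := cD e (hD _ De); apply: le_trans ed _.
  by have /andP[] := dotp_unit_itv (hD _ De) (hD _ Dd).
have cN1 : -1 <= c <= 1 by rewrite c1 andbT; lra.
have theta_itv : 0 <= acos c < pi / 2.
  rewrite acos_ge0 // -acos0 ltr_acos //; lra.
exists (acos c) => //; split => // g g1.
have [d Dd gd] := cD g g1; exists d => //.
have gd1 := dotp_unit_itv g1 (hD _ Dd).
by rewrite leNgt ltr_acos // -leNgt.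
Qed.

Lemma theta_cover_dotp_ge D (theta : R) g :
    D !=set0 -> D `<=` @unit_sphere R N -> theta_cover theta D ->
  exists2 d, D d & cos theta * enorm g <= dotp g d.
Proof.
move=> [e De] hD [/andP[theta0 theta2] cover].
have [->|g0] := eqVneq g 0.
  by exists e => //; rewrite enorm0 mulr0 dotp0l.
have [d Dd gd] := cover _ (enorm_normalize g0); exists d => //.
have gd1 := dotp_unit_itv (enorm_normalize g0) (hD _ Dd).
have : cos theta <= dotp ((enorm g)^-1 *: g) d.
  rewrite -[leRHS]acosK ?in_itv // leNgt ltr_cos ?in_itv /=.
  - by rewrite -leNgt.
  - by rewrite theta0; have := pi_gt0 R; lra.
  - by rewrite acos_ge0 // acos_lepi.
by rewrite dotpZl mulrC ler_pdivlMr ?enorm_gt0.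
Qed.

(** Greedy descent: at each point pick a direction of [D] within angle [theta]
    of the gradient. *)
Lemma theta_cover_proper_quantization (L theta : R) D :
    0 < L -> D !=set0 -> D `<=` @unit_sphere R N -> theta_cover theta D ->
  proper_quantization L D.
Proof.
move=> L0 D0 hD cover f fL x0.
have [theta0 theta2] := andP cover.1.
have c0 : 0 < cos theta.
  by apply: cos_gt0_pihalf; rewrite theta2 andbT; have := pi_gt0 R; lra.
have dirP x : exists d,
    D d /\ cos theta * enorm (gradient f x) <= dotp (gradient f x) d.
  by have [d] := theta_cover_dotp_ge (gradient f x) D0 hD cover; exists d.
have [dir {}dirP] := choice dirP.
pose step x := dotp (gradient f x) (dir x) / (2 * L).
pose x t := iter t (fun y => y - step y *: dir y) x0.
exists (dir \o x), (step \o x), x; split=> // [t|t|].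
- exact: (dirP _).1.
- rewrite divr_ge0 ?mulr_ge0 ?(ltW L0) //.
  by apply: le_trans (dirP _).2; rewrite mulr_ge0 ?enorm_ge0 ?ltW.
have k0 : 0 < cos theta ^+ 2 / (4 * L).
  by rewrite divr_gt0 ?exprn_gt0 ?mulr_gt0.
apply: (sufficient_decrease_cvg fL k0) => t.
have [Dd cd] := dirP (x t).
exact: step_decrease L0 (ltW c0) fL (hD _ Dd) cd.
Qed.

End cover.

(** * The equivalence *)

Theorem theorem1 (R : realType) (N : nat) (hN : (1 <= N)%N) (L : R)
    (hL : 0 < L) (D : set 'rV[R]_N) (hDfin : finite_set D)
    (hD : D `<=` @unit_sphere R N) :
  proper_quantization L D <->
  exists2 theta : R, 0 <= theta < pi / 2 & theta_cover theta D.
Proof.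
pose e : 'rV[R]_N := delta_mx ord0 (Ordinal hN).
have e1 : enorm e = 1 by rewrite /enorm dotp_deltar mxE !eqxx sqrtr1.
split=> [proper|[theta _ cover]].
  have pos := proper_quantization_dotp_gt0 hL proper.
  have [c c0 cD] := uniformly_positive_dotp hDfin pos.
  have [d Dd _] := pos e e1.
  by apply: (uniformly_positive_dotp_theta_cover _ hD c0 cD); exists d.
have [d Dd _] := cover.2 e e1.
by apply: (theta_cover_proper_quantization hL _ hD cover); exists d.
Qed.
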